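(* Consider the loss-only experts problem with $N$ experts: an oblivious adversary fixes loss vectors $\ell_1,\dots,\ell_T\in[0,1]^N$; at round $t$ the learner picks $i_t\in[N]$, incurs $\ell_{t,i_t}$ and then observes $\ell_t$. Let $L_{t}=\sum_{s\le t}\ell_s$ and $L_T^*=\min_i L_{T,i}$. The follow-the-perturbed-leader (FTPL) algorithm with perturbation distribution $\mathcal{D}$ plays $i_t$ drawn from $p_t=\nabla\tilde\Phi_{\mathcal{D}}(L_{t-1})$, where $\tilde\Phi_{\mathcal{D}}(L)=\mathbb{E}_{Z_1,\dots,Z_N\sim\mathcal{D}\text{ i.i.d.}}[\min_i(L_i-Z_i)]$, i.e. $p_{t,i}=\mathbb{P}(i=\arg\min_{i'}(L_{t-1,i'}-Z_{i'}))$. Then FTPL with Gamma, Gumbel, Fréchet, Weibull, and Pareto perturbations, each with a proper choice of distribution parameters, achieves expected regret $\mathbb{E}[\sum_{t=1}^T\ell_{t,i_t}]-L_T^*=O(\sqrt{L_T^*\log N}+\log N)$.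
   Context: The distribution parameters (including a scale parameter) may be chosen depending on $N$ and $L_T^*$. Expectation is over the learner's randomness. *)

(* Defs.v *)
From HB Require Import structures.
From mathcomp Require Import all_boot all_order all_algebra.
From mathcomp Require Import all_classical all_reals all_analysis.
Set Implicit Arguments. Unset Strict Implicit. Unset Printing Implicit Defensive.
Import Order.TTheory GRing.Theory Num.Theory Num.Def.
Import numFieldNormedType.Exports.
Local Open Scope classical_set_scope.
Local Open Scope ring_scope.

Section FTPL.
Variable R : realType.

(** Loss sequences: [ell t i] is the loss of expert [i] at round [t]
    (rounds are numbered 0, ..., T-1). *)

Definition Lcum (N : nat) (ell : nat -> 'I_N -> R) (t : nat) (i : 'I_N) : R :=
  \sum_(s < t) ell s i.

(** L_T^* = min_i L_{T,i} (N >= 1 experts, so this is a genuine minimum). *)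
Definition Lstar (N : nat) (ell : nat -> 'I_N -> R) (T : nat) : R :=
  inf [set Lcum ell T i | i in [set: 'I_N]].

(** Event "i = argmin_{i'} (L_{i'} - Z_{i'})", ties broken towards the smallest
    index (ties have probability 0 for all continuous perturbations below). *)
Definition is_argmin (N : nat) (L : 'I_N -> R) (z : 'I_N -> R) (i : 'I_N) : Prop :=
  forall j : 'I_N, L i - z i <= L j - z j /\ ((j < i)%N -> L i - z i < L j - z j).

Definition iid_with_cdf d (Omega : measurableType d) (P : probability Omega R)
    (N : nat) (Z : 'I_N -> {RV P >-> R}) (F : R -> R) : Prop :=
  (forall B : 'I_N -> set R, (forall i, measurable (B i)) ->
     fine (P (\bigcap_(i in [set: 'I_N]) (Z i @^-1` B i)))
     = \prod_(i < N) fine (P (Z i @^-1` B i)))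
  /\ (forall i x, cdf (Z i) x = (F x)%:E).

(** FTPL probability p_{t,i} = P(i = argmin_{i'} (L_{t-1,i'} - Z_{i'})),
    where L_{t-1} is the cumulative loss before round t. *)
Definition ftpl_prob d (Omega : measurableType d) (P : probability Omega R)
    (N : nat) (Z : 'I_N -> {RV P >-> R}) (ell : nat -> 'I_N -> R) (t : nat)
    (i : 'I_N) : R :=
  fine (P [set w | is_argmin (Lcum ell t) (fun j => Z j w) i]).

(** Expected regret E[sum_t ell_{t,i_t}] - L_T^* of FTPL against the oblivious
    loss sequence ell (by linearity, E[ell_{t,i_t}] = sum_i p_{t,i} ell_{t,i}). *)
Definition ftpl_expected_regret d (Omega : measurableType d)
    (P : probability Omega R) (N : nat) (Z : 'I_N -> {RV P >-> R})
    (ell : nat -> 'I_N -> R) (T : nat) : R :=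
  \sum_(t < T) \sum_(i < N) ftpl_prob Z ell t i * ell t i - Lstar ell T.

Definition achieves_small_loss_regret (Theta : Type) (ok : Theta -> Prop)
    (F : Theta -> R -> R) : Prop :=
  exists (C : R) (choose : nat -> R -> Theta),
    (forall N Ls, ok (choose N Ls)) /\
    forall (N T : nat) (ell : nat -> 'I_N -> R),
      (0 < N)%N ->
      (forall t i, (t < T)%N -> 0 <= ell t i <= 1) ->
      forall (d : measure_display) (Omega : measurableType d)
             (P : probability Omega R) (Z : 'I_N -> {RV P >-> R}),
        iid_with_cdf Z (F (choose N (Lstar ell T))) ->
        ftpl_expected_regret Z ell T
          <= C * (Num.sqrt (Lstar ell T * ln N%:R) + ln N%:R).

(** Gamma(k, theta): shape k > 0, scale theta > 0; density proportional to
    x^(k-1) e^(-x/theta) on (0, +oo). The CDF is written as the normalised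
    integral of the unnormalised density. *)
Definition gamma_ok (p : R * R) : Prop := 0 < p.1 /\ 0 < p.2.
Definition gamma_dens (p : R * R) (x : R) : R :=
  x `^ (p.1 - 1) * expR (- (x / p.2)).
Definition gamma_cdf (p : R * R) (x : R) : R :=
  if x <= 0 then 0 else
  fine (\int[lebesgue_measure]_(y in `]0, x]) (gamma_dens p y)%:E) /
  fine (\int[lebesgue_measure]_(y in `]0, +oo[) (gamma_dens p y)%:E).

(** Gumbel(mu, beta): location mu, scale beta > 0. *)
Definition gumbel_ok (p : R * R) : Prop := 0 < p.2.
Definition gumbel_cdf (p : R * R) (x : R) : R :=
  expR (- expR (- ((x - p.1) / p.2))).

(** Frechet(alpha, s, m): shape alpha > 0, scale s > 0, location m. *)
Definition frechet_ok (p : R * R * R) : Prop := 0 < p.1.1 /\ 0 < p.1.2.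
Definition frechet_cdf (p : R * R * R) (x : R) : R :=
  if x <= p.2 then 0 else expR (- (((x - p.2) / p.1.2) `^ (- p.1.1))).

(** Weibull(k, lambda): shape k > 0, scale lambda > 0. *)
Definition weibull_ok (p : R * R) : Prop := 0 < p.1 /\ 0 < p.2.
Definition weibull_cdf (p : R * R) (x : R) : R :=
  if x <= 0 then 0 else 1 - expR (- ((x / p.2) `^ p.1)).

(** Pareto(alpha, x_m): shape alpha > 0, scale x_m > 0. *)
Definition pareto_ok (p : R * R) : Prop := 0 < p.1 /\ 0 < p.2.
Definition pareto_cdf (p : R * R) (x : R) : R :=
  if x <= p.2 then 0 else 1 - (p.2 / x) `^ p.1.

End FTPL.

(* Main.v *)
Require Import Defs.
From HB Require Import structures.
From mathcomp Require Import all_boot all_order all_algebra.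
From mathcomp Require Import all_classical all_reals all_analysis.
From mathcomp Require Import measurable_realfun ring lra.
Set Implicit Arguments. Unset Strict Implicit. Unset Printing Implicit Defensive.
Import Order.TTheory GRing.Theory Num.Theory Num.Def.
Import numFieldNormedType.Exports.
Local Open Scope classical_set_scope.
Local Open Scope ring_scope.

(** If the perturbation has hazard rate at most [eta], i.e.
    [P (Z > x) <= e^(eta y) P (Z > x + y)], then conditioning on the other
    perturbations gives [p_(t,i) <= e^(eta ell_(t,i)) p_(t+1,i)]: playing [p_t]
    costs at most [e^eta] times as much as playing the next distribution.
    The latter is the perturbed leader after the fact, whose loss is at most
    [L^* + E (max_i Z_i - Z_j)].  If moreover the last expectation is
    [O(log N / eta)], the regret is at most
    [(e^eta - 1) L^* + O(log N / eta)], and [eta = 1 / (2 + sqrt (L^* / log N))]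
    gives the bound.

    Each of the five families has a member with these two properties: Gamma and
    Weibull of shape 1 are both the exponential law of rate [eta]; Gumbel of
    scale [1 / eta]; Pareto and Frechet of shape [4 log N] and scale of order
    [log N / eta]. *)

(** * Perturbed leaders for a fixed perturbation *)

Section Argmin.
Variables (R : realType) (N : nat).
Implicit Types (L z : 'I_N -> R) (i j : 'I_N) (ell : nat -> 'I_N -> R).

Lemma is_argmin_exists L z : (0 < N)%N -> exists i, is_argmin L z i.
Proof.
move=> N0; pose v i := L i - z i.
have [i1 _ Hi1] := @Order.TotalTheory.arg_minP _ R _ (Ordinal N0) predT v isT.
have [i2 /eqP Hi2 min2] := @arg_minnP _ i1 (fun i => v i == v i1) (@nat_of_ord N) (eqxx _).
exists i2 => j; rewrite -!/(v _) Hi2; split; first exact: Hi1.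
move=> ji2; rewrite lt_neqAle Hi1// andbT; apply/negP => /eqP e.
by have := min2 j; rewrite e eqxx leqNgt ji2 => /(_ isT).
Qed.

Lemma is_argmin_uniq L z i j : is_argmin L z i -> is_argmin L z j -> i = j.
Proof.
move=> Hi Hj; apply/val_inj => /=; case: (ltngtP i j) => // ij.
  by have [_ /(_ ij)] := Hj i; have [+ _] := Hi j; move=> /le_lt_trans H /H; rewrite ltxx.
by have [_ /(_ ij)] := Hi j; have [+ _] := Hj i; move=> /le_lt_trans H /H; rewrite ltxx.
Qed.

(** Induction on [T]: the hypothesis is used with comparator [I T.+1], which in turn beats [j] after
    round [T]. One [z] may serve all rounds, since the expected regret depends only on the law of
    each single play. *)
Lemma be_the_perturbed_leader ell z (I : nat -> 'I_N) (T : nat) :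
  (forall t, is_argmin (Lcum ell t) z (I t)) ->
  forall j, \sum_(t < T) ell t (I t.+1) <= Lcum ell T j - z j + z (I 0%N).
Proof.
move=> HI; elim: T => [|T IH] j.
  by have [+ _] := HI 0%N j; rewrite /Lcum !big_ord0; lra.
rewrite big_ord_recr /=; have [+ _] := HI T.+1 j; have := IH (I T.+1).
rewrite /Lcum !big_ord_recr /=; lra.
Qed.

Lemma Lstar_le ell (T : nat) j : Lstar ell T <= Lcum ell T j.
Proof.
apply: ge_inf; last by exists j.
have [i0 Hi0] := is_argmin_exists (Lcum ell T) (fun=> 0) (leq_ltn_trans (leq0n j) (ltn_ord j)).
by exists (Lcum ell T i0) => _ [k _ <-]; have [+ _] := Hi0 k; rewrite !subr0.
Qed.

Lemma Lstar_attained ell (T : nat) : (0 < N)%N -> exists i, Lstar ell T = Lcum ell T i.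
Proof.
move=> N0; have [i Hi] := is_argmin_exists (Lcum ell T) (fun=> 0) N0.
exists i; apply/eqP; rewrite eq_le Lstar_le /=; apply: lb_le_inf; first by exists (Lcum ell T i), i.
by move=> _ [k _ <-]; have [+ _] := Hi k; rewrite !subr0.
Qed.

Lemma sum_is_argmin L z i (f : 'I_N -> R) : is_argmin L z i ->
  \sum_(j < N) f j * `[< is_argmin L z j >]%:R = f i.
Proof.
move=> Hi; rewrite (bigD1 i)//= asboolT// mulr1 big1 ?addr0// => j ji.
by rewrite asboolF ?mulr0// => Hj; rewrite (is_argmin_uniq Hi Hj) eqxx in ji.
Qed.

End Argmin.

(** A discrete layer-cake bound: [w] times the number of levels [k * w] below [y] dominates [y]
    until all [K] levels are used up. *)
Lemma min_le_count (R : realType) (y w : R) (K : nat) : 0 <= w ->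
  Num.min y (K%:R * w) <= w * \sum_(k < K) (k%:R * w < y)%R%:R.
Proof.
move=> w0; elim: K => [|K IH]; first by rewrite big_ord0 mul0r mulr0 ge_min lexx orbT.
rewrite big_ord_recr /= mulrDr -natr1; move: IH.
set s := w * \sum_(_ < _) _ => IH.
have [yK|yK] := boolP (K%:R * w < y); rewrite /= ?mulr1 ?mulr0 ?addr0.
  move: IH; rewrite (min_idPr (ltW yK)) => IH.
  by rewrite ge_min mulrDl mul1r lerD2r IH orbT.
move: yK; rewrite -leNgt => yK; move: IH; rewrite (min_idPl yK) => IH.
by rewrite ge_min IH.
Qed.

(** * Real-valued probabilities and expectations *)

Section Prob.
Context d (Omega : measurableType d) (R : realType) (P : probability Omega R).
Local Notation pr A := (fine (P A)).

Lemma pr_ge0 (A : set Omega) : 0 <= pr A.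
Proof. exact: fine_ge0. Qed.

Lemma le_pr (A B : set Omega) : measurable A -> measurable B -> A `<=` B -> pr A <= pr B.
Proof. by move=> mA mB AB; rewrite fine_le ?fin_num_measure// le_measure// inE. Qed.

Lemma prU (A B : set Omega) : measurable A -> measurable B -> A `&` B = set0 ->
  pr (A `|` B) = pr A + pr B.
Proof. by move=> mA mB AB; rewrite measureU// fineD ?fin_num_measure. Qed.

Lemma prC (A : set Omega) : measurable A -> pr (~` A) = 1 - pr A.
Proof. by move=> mA; rewrite probability_setC// fineB ?fin_num_measure. Qed.

Lemma prID (A B : set Omega) : measurable A -> measurable B ->
  pr A = pr (A `&` B) + pr (A `\` B).
Proof.
move=> mA mB; rewrite -prU; [|exact: measurableI|exact: measurableD|].
  by rewrite setUIDK.
by rewrite setDE setIACA setICr setI0.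
Qed.

(** Integrability is bundled with the value, so that means add and compare without side
    conditions. *)
Definition has_mean (X : Omega -> R) (v : R) :=
  P.-integrable setT (EFin \o X) /\ (\int[P]_x (X x)%:E = v%:E)%E.

Lemma has_mean_indic (A : set Omega) : measurable A ->
  has_mean (fun x => `[< A x >]%:R) (pr A).
Proof.
move=> mA; have -> : (fun x => `[< A x >]%:R : R) = \1_A.
  by apply/funext => x; rewrite indicE.
split; first by apply: integrable_indic => //; rewrite -ge0_fin_numE// fin_num_measure.
by rewrite integral_indic// setIT fineK// fin_num_measure.
Qed.

Lemma has_meanZ (c : R) X v : has_mean X v -> has_mean (fun x => c * X x) (c * v).
Proof.
move=> [iX eX]; split; first exact: (integrableZl measurableT c iX).
by under eq_integral do rewrite EFinM; rewrite integralZl// eX.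
Qed.

Lemma has_mean_sum (I : finType) (X : I -> Omega -> R) (v : I -> R) :
  (forall i, has_mean (X i) (v i)) ->
  has_mean (fun x => \sum_i X i x) (\sum_i v i).
Proof.
move=> H; have e : EFin \o (fun x => \sum_i X i x) = (fun x => \sum_i (X i x)%:E)%E.
  by apply/funext => x /=; rewrite sumEFin.
split; first by rewrite e; apply: integrable_sum => // i *; case: (H i).
under eq_integral do rewrite -sumEFin.
rewrite integral_sum//; last by move=> i *; case: (H i).
by rewrite -sumEFin; apply: eq_bigr => i _; case: (H i).
Qed.

Lemma has_meanD X Y u v : has_mean X u -> has_mean Y v ->
  has_mean (fun x => X x + Y x) (u + v).
Proof.
move=> [iX eX] [iY eY]; split; first exact: (integrableD measurableT iX iY).
by under eq_integral do rewrite EFinD; rewrite integralD//= eX eY.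
Qed.

Lemma has_mean_cst c : has_mean (fun=> c) c.
Proof.
split; first exact: finite_measure_integrable_cst.
by rewrite (integral_cst P measurableT c%:E) [X in (_ * X)%E](@probability_setT _ _ _ P) mule1.
Qed.

Lemma has_mean_le X Y u v : has_mean X u -> has_mean Y v ->
  (forall x, X x <= Y x) -> u <= v.
Proof.
move=> [iX eX] [iY eY] XY; rewrite -lee_fin -eX -eY.
by apply: le_integral => // x _; rewrite lee_fin.
Qed.

End Prob.

(** * Stability of the law of the leader under one round of losses *)

Section Stability.
Context d (Omega : measurableType d) (R : realType) (P : probability Omega R).
Variables (N : nat) (Z : 'I_N -> {RV P >-> R}) (F : R -> R).
Hypothesis Ziid : iid_with_cdf Z F.
Local Notation pr A := (fine (P A)).

Lemma measurable_RV_le (i : 'I_N) (x : R) : measurable [set w | Z i w <= x].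
Proof.
have -> : [set w | Z i w <= x] = Z i @^-1` `]-oo, x]%classic by rewrite set_itvNyc.
exact: measurable_funPTI.
Qed.

Lemma measurable_RV_gt (i : 'I_N) (x : R) : measurable [set w | x < Z i w].
Proof.
have -> : [set w | x < Z i w] = ~` [set w | Z i w <= x].
  by apply/seteqP; split => w /=; rewrite ltNge => /negP.
exact: measurableC (measurable_RV_le i x).
Qed.

Lemma pr_RV_le (i : 'I_N) (x : R) : pr [set w | Z i w <= x] = F x.
Proof.
have := Ziid.2 i x; rewrite /cdf /distribution /pushforward /= => e.
by rewrite -[RHS]/(fine (F x)%:E) -e; congr (fine (P _)); rewrite set_itvNyc.
Qed.

Lemma pr_RV_gt (i : 'I_N) (x : R) : pr [set w | x < Z i w] = 1 - F x.
Proof.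
have -> : [set w | x < Z i w] = ~` [set w | Z i w <= x].
  by apply/seteqP; split => w /=; rewrite ltNge => /negP.
by rewrite prC ?pr_RV_le//; exact: measurable_RV_le.
Qed.

Lemma measurable_is_argmin (L : 'I_N -> R) (i : 'I_N) :
  measurable [set w | is_argmin L (fun j => Z j w) i].
Proof.
have mZ j : measurable_fun setT (fun w => L j - Z j w).
  by apply: measurable_funB => //; exact: measurable_cst.
have -> : [set w | is_argmin L (fun j => Z j w) i] = \bigcap_(j in [set: 'I_N])
    ([set w | L i - Z i w <= L j - Z j w] `&`
     (if (j < i)%N then [set w | L i - Z i w < L j - Z j w] else setT)).
  apply/seteqP; split => w /= H j => [_|].
    by have [H1 H2] := H j; split => //; case: ifPn.
  by have [H1] := H j I; case: ifPn => //= _ H2.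
apply: fin_bigcap_measurable; first exact: finite_finset.
move=> j _; apply: measurableI.
  by rewrite -[X in measurable X]setTI; exact: measurable_fun_le.
case: ifPn => // _.
have -> : [set w | L i - Z i w < L j - Z j w] = ~` [set w | L j - Z j w <= L i - Z i w].
  by apply/seteqP; split => w /=; rewrite ltNge => /negP.
by apply: measurableC; rewrite -[X in measurable X]setTI; exact: measurable_fun_le.
Qed.

(* In terms of [M := max_(j != i) (Z j - L j + L i)], which is independent of
   [Z i], this is the event [M <= m], and [i] is the leader iff [Z i] exceeds
   [M] (up to ties). *)
Definition rivals_below (L : 'I_N -> R) (i : 'I_N) (m : R) : set Omega :=
  [set w | forall j, j != i -> Z j w <= m + (L j - L i)].

(** The sides of a box, [C] for expert [i] and a half-line for each rival: the independence
    hypothesis speaks of boxes. *)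
Let B (L : 'I_N -> R) (i : 'I_N) (m : R) (C : set R) (j : 'I_N) : set R :=
  if j == i then C else [set x | x <= m + (L j - L i)].

Let measurable_B L i m C j : measurable C -> measurable (B L i m C j).
Proof.
by move=> mC; rewrite /B; case: ifP => // _; rewrite -set_itvNyc; exact: measurable_itv.
Qed.

Let rivals_belowE L i m C :
  rivals_below L i m `&` (Z i @^-1` C) = \bigcap_(j in [set: 'I_N]) (Z j @^-1` B L i m C j).
Proof.
apply/seteqP; split => w /=.
  move=> [H1 H2] j _; rewrite /B /=; case: eqP => [->//|/eqP ji]; exact: H1.
move=> H; split; last by have := H i I; rewrite /B eqxx.
by move=> j ji; have := H j I; rewrite /B (negbTE ji).
Qed.

Lemma measurable_rivals_below L i m : measurable (rivals_below L i m).
Proof.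
rewrite -[X in measurable X]setIT -[setT](preimage_setT (Z i)) rivals_belowE.
apply: fin_bigcap_measurable => [|j _]; first exact: finite_finset.
by apply: measurable_funPTI; exact: measurable_B.
Qed.

Lemma rivals_below_indep L i m C : measurable C ->
  pr (rivals_below L i m `&` (Z i @^-1` C)) = pr (rivals_below L i m) * pr (Z i @^-1` C).
Proof.
have H D : measurable D -> pr (rivals_below L i m `&` (Z i @^-1` D)) =
    pr (Z i @^-1` D) * \prod_(j < N | j != i) F (m + (L j - L i)).
  move=> mD; rewrite rivals_belowE Ziid.1; last by move=> j; exact: measurable_B.
  rewrite (bigD1 i)//= {1}/B eqxx; congr (_ * _); apply: eq_bigr => j ji.
  by rewrite /B (negbTE ji) -(pr_RV_le j).
(* Taking the whole line for [C] identifies the product over the rivals. *)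
move=> mC; rewrite H//; have := H setT measurableT.
rewrite preimage_setT setIT probability_setT /= mul1r => ->; exact: mulrC.
Qed.

Lemma rivals_below_homo L i m m' : m <= m' ->
  rivals_below L i m `<=` rivals_below L i m'.
Proof. by move=> mm w H j /H; lra. Qed.

Lemma pr_setI_rivals L i m m' (D : set Omega) : measurable D -> m <= m' ->
  pr (D `&` rivals_below L i m') - pr (D `&` rivals_below L i m) =
  pr (D `&` (rivals_below L i m' `\` rivals_below L i m)).
Proof.
move=> mD mm; have mA x := measurable_rivals_below L i x.
rewrite (@prID _ _ _ P (D `&` rivals_below L i m') (rivals_below L i m))//;
  last exact: measurableI.
have -> : D `&` rivals_below L i m' `&` rivals_below L i m = D `&` rivals_below L i m.
  by rewrite -setIA (setIidr (rivals_below_homo mm)).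
by rewrite setIDA addrC addKr.
Qed.

Lemma rivals_between_indep L i m m' x : m <= m' ->
  pr ([set w | x < Z i w] `&` (rivals_below L i m' `\` rivals_below L i m)) =
  (pr (rivals_below L i m') - pr (rivals_below L i m)) * (1 - F x).
Proof.
move=> mm; rewrite -pr_setI_rivals//; last exact: measurable_RV_gt.
have -> : [set w | x < Z i w] = Z i @^-1` `]x, +oo[%classic.
  by rewrite set_itvoy.
rewrite !(setIC (Z i @^-1` _)) !rivals_below_indep// -mulrBl; congr (_ * _).
by rewrite -(pr_RV_gt i); congr (fine (P _)); rewrite set_itvoy.
Qed.

Variable eta : R.
Hypothesis F_tail : forall x y, 0 <= y -> 1 - F x <= expR (eta * y) * (1 - F (x + y)).

(** On the cell [m < M <= m'], leading before the losses [l] forces [Z i > m], while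
    [Z i > m' + l i] suffices to lead after them, as the losses of rivals only help. The thresholds
    differ by [l i + (m' - m)], and [F_tail] prices this shift. *)
Lemma is_argmin_between (L l : 'I_N -> R) i m m' : (forall j, 0 <= l j) -> m <= m' ->
  pr ([set w | is_argmin L (fun j => Z j w) i] `&`
      (rivals_below L i m' `\` rivals_below L i m)) <=
  expR (eta * (l i + (m' - m))) *
  pr ([set w | is_argmin (fun j => L j + l j) (fun j => Z j w) i] `&`
      (rivals_below L i m' `\` rivals_below L i m)).
Proof.
move=> l0 mm; have mA x := measurable_rivals_below L i x.
have mD : measurable (rivals_below L i m' `\` rivals_below L i m) by exact: measurableD.
have mI A : measurable A -> measurable (A `&` (rivals_below L i m' `\` rivals_below L i m)).
  by move=> ?; exact: measurableI.
apply: (@le_trans _ _ (pr ([set w | m < Z i w] `&`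
    (rivals_below L i m' `\` rivals_below L i m)))).
  apply: le_pr; [by apply: mI; exact: measurable_is_argmin
    |by apply: mI; exact: measurable_RV_gt|].
  move=> w [/= Hw [H1 H2]]; split => //=; rewrite ltNge; apply/negP => Zm; apply: H2.
  by move=> j _; have [+ _] := Hw j; lra.
apply: (@le_trans _ _ (expR (eta * (l i + (m' - m))) *
    pr ([set w | m' + l i < Z i w] `&` (rivals_below L i m' `\` rivals_below L i m)))).
  rewrite !rivals_between_indep// mulrCA ler_wpM2l//.
    by rewrite subr_ge0 le_pr//; exact: rivals_below_homo.
  have -> : m' + l i = m + (l i + (m' - m)) by lra.
  by apply: F_tail; rewrite addr_ge0// subr_ge0.
rewrite ler_wpM2l ?expR_ge0// le_pr//; [by apply: mI; exact: measurable_RV_gt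
  |by apply: mI; exact: measurable_is_argmin|].
move=> w [/= Hw [H1 H2]]; split => //= j.
have [->|ji] := eqVneq j i; first by rewrite ltnn.
have := H1 j ji; have := l0 j => ? ?; split=> [|_]; lra.
Qed.

(* Slices [M] into cells of width [h]; the factor [expR (eta * h)] lost on each
   cell tends to 1 as [h] tends to 0, so Fubini's theorem is not needed. *)
Lemma is_argmin_below (L l : 'I_N -> R) i m m' : (forall j, 0 <= l j) -> m <= m' ->
  pr ([set w | is_argmin L (fun j => Z j w) i] `&` rivals_below L i m') <=
  pr (rivals_below L i m) +
  expR (eta * l i) * pr [set w | is_argmin (fun j => L j + l j) (fun j => Z j w) i].
Proof.
move=> l0 mm; have mA x := measurable_rivals_below L i x.
set E := [set w | is_argmin L _ i]; set E' := [set w | is_argmin _ _ i].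
have mE : measurable E by exact: measurable_is_argmin.
have mE' : measurable E' by exact: measurable_is_argmin.
pose g x := pr (E `&` rivals_below L i x); pose g' x := pr (E' `&` rivals_below L i x).
have step h : 0 < h -> forall n : nat, g (m + n%:R * h) - g m <=
    expR (eta * (l i + h)) * (g' (m + n%:R * h) - g' m).
  move=> h0; elim=> [|n IH]; first by rewrite mul0r addr0 !subrr mulr0.
  set x := m + n%:R * h in IH *; have -> : m + n.+1%:R * h = x + h.
    by rewrite -natr1 /x mulrDl mul1r addrA.
  have xh : x <= x + h by rewrite lerDl ltW.
  have := @is_argmin_between L l i x (x + h) l0 xh.
  rewrite -!(pr_setI_rivals _ _ _ xh)// -/E -/E' -/(g _) -/(g _) -/(g' _) -/(g' _).
  have -> : x + h - x = h by lra.
  lra.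
have bound n : g m' <= pr (rivals_below L i m) +
    expR (eta * (l i + (m' - m) / n.+1%:R)) * pr E'.
  have gm : g m <= pr (rivals_below L i m).
    by apply: le_pr => //; exact: measurableI.
  have [mm'|] := ltP m m'; last first.
    move=> m'm; have <- : m = m' by apply/eqP; rewrite eq_le mm.
    apply: (le_trans gm); rewrite lerDl mulr_ge0 ?expR_ge0//; exact: pr_ge0.
  have h0 : 0 < (m' - m) / n.+1%:R by rewrite divr_gt0// subr_gt0.
  have e : m + n.+1%:R * ((m' - m) / n.+1%:R) = m'.
    by rewrite [n.+1%:R * _]mulrC divfK// addrC subrK.
  have := step _ h0 n.+1; rewrite e => H.
  apply: (@le_trans _ _ (g m + expR (eta * (l i + (m' - m) / n.+1%:R)) * (g' m' - g' m))).
    by rewrite -lerBlDl.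
  rewrite lerD// ler_wpM2l ?expR_ge0// lerBlDr.
  apply: (@le_trans _ _ (pr E')); first by apply: le_pr => //; exact: measurableI.
  by rewrite lerDl; exact: pr_ge0.
have cv : (fun n : nat => pr (rivals_below L i m) +
    expR (eta * (l i + (m' - m) / n.+1%:R)) * pr E') @ \oo -->
    pr (rivals_below L i m) + expR (eta * (l i + (m' - m) * 0)) * pr E'.
  apply: cvgD; first exact: cvg_cst.
  apply: cvgM; last exact: cvg_cst.
  apply: (@continuous_cvg _ _ _ _ _ _ (@expR R)); first exact: continuous_expR.
  apply: cvgM; first exact: cvg_cst.
  apply: cvgD; first exact: cvg_cst.
  apply: cvgM; first exact: cvg_cst.
  exact: cvg_harmonic.
rewrite mulr0 addr0 in cv.
rewrite -/(g m') -(cvg_lim _ cv)//; apply: limr_ge; first exact: (cvgP _ cv).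
by near=> n; exact: bound.
Unshelve. all: by end_near. Qed.

Lemma cvg_rivals_belowy L i : pr (rivals_below L i n%:R) @[n --> \oo] --> (1 : R).
Proof.
have mA x := measurable_rivals_below L i x.
apply: fine_cvg; rewrite -(probability_setT P).
have <- : \bigcup_n rivals_below L i n%:R = setT.
  rewrite -subTset => w _; pose s := \sum_j `|Z j w - (L j - L i)|.
  exists (truncn s).+1 => // j _.
  have : `|Z j w - (L j - L i)| <= s by rewrite /s (bigD1 j)//= lerDl sumr_ge0.
  have := truncnS_gt s; have := ler_norm (Z j w - (L j - L i)); lra.
apply: nondecreasing_cvg_mu => //; first exact: bigcup_measurable.
by move=> n k nk; apply/subsetPset; apply: rivals_below_homo; rewrite ler_nat.
Qed.

(** With at least one rival, [M] is never minus infinity. *)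
Lemma cvg_rivals_belowNy L i : (1 < N)%N ->
  pr (rivals_below L i (- n%:R)) @[n --> \oo] --> (0 : R).
Proof.
move=> N1; have mA x := measurable_rivals_below L i x.
have [j ji] : exists j : 'I_N, j != i.
  have [i0|i0] := eqVneq (nat_of_ord i) 0%N.
    by exists (Ordinal N1); rewrite -val_eqE /= i0.
  by exists (Ordinal (ltnW N1)); rewrite -val_eqE /= eq_sym.
apply: fine_cvg; rewrite -[0%:E](measure0 P).
have <- : \bigcap_n rivals_below L i (- n%:R) = set0.
  rewrite -subset0 => w /(_ (truncn (L j - L i - Z j w)).+1 I) /(_ j ji).
  by have := truncnS_gt (L j - L i - Z j w); lra.
apply: nonincreasing_cvg_mu => //=.
- by rewrite (le_lt_trans (probability_le1 _ _)) ?ltry.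
- exact: bigcap_measurable.
- by move=> n k nk; apply/subsetPset; apply: rivals_below_homo; rewrite lerN2 ler_nat.
Qed.

(** The range of [M] between [-n] and [n] is covered by [is_argmin_below]; the two remaining events
    have probabilities tending to 0. *)
Lemma is_argmin_stable (L l : 'I_N -> R) i : (1 < N)%N -> (forall j, 0 <= l j) ->
  pr [set w | is_argmin L (fun j => Z j w) i] <=
  expR (eta * l i) * pr [set w | is_argmin (fun j => L j + l j) (fun j => Z j w) i].
Proof.
move=> N1 l0; have mA x := measurable_rivals_below L i x.
set E := [set w | is_argmin L _ i]; set E' := [set w | is_argmin _ _ i].
have mE : measurable E by exact: measurable_is_argmin.
have cv : (fun n : nat => pr (rivals_below L i (- n%:R)) +
    expR (eta * l i) * pr E' + (1 - pr (rivals_below L i n%:R))) @ \oo -->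
    0 + expR (eta * l i) * pr E' + (1 - 1).
  apply: cvgD.
    by apply: cvgD; [exact: cvg_rivals_belowNy|exact: cvg_cst].
  by apply: cvgB; [exact: cvg_cst|exact: cvg_rivals_belowy].
rewrite subrr addr0 add0r in cv; rewrite -(cvg_lim _ cv)//.
apply: limr_ge; first exact: (cvgP _ cv).
near=> n; rewrite (prID P mE (mA n%:R)) lerD//.
  by apply: is_argmin_below => //; rewrite -subr_ge0 opprK addr_ge0.
by rewrite -prC//; apply: le_pr; [exact: measurableD|exact: measurableC|move=> w []].
Unshelve. all: by end_near. Qed.

End Stability.

(** The sum telescopes: each term is [2 / k.+1 - 2 / k.+2]. *)
Lemma sum_inv_triangular_le (R : realType) (K : nat) :
  \sum_(k < K) 2 / (k.+1%:R * k.+2%:R) <= 2 :> R.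
Proof.
suff -> : \sum_(k < K) 2 / (k.+1%:R * k.+2%:R) = 2 - 2 / K.+1%:R :> R.
  by rewrite gerBl divr_ge0.
elim: K => [|K IH]; first by rewrite big_ord0 divr1 subrr.
rewrite big_ord_recr /= IH -(natr1 K.+1) -(natr1 K).
have K0 : 0 <= K%:R :> R by [].
by field; rewrite !gt_eqF//; lra.
Qed.

(** * Regret bound from the hazard rate and the tails *)

Section Regret.
Context d (Omega : measurableType d) (R : realType) (P : probability Omega R).
Variables (N : nat) (Z : 'I_N -> {RV P >-> R}) (F : R -> R).
Hypothesis Ziid : iid_with_cdf Z F.
Variables (ell : nat -> 'I_N -> R) (T : nat).
Hypothesis ell01 : forall t i, (t < T)%N -> 0 <= ell t i <= 1.
Hypothesis N1 : (1 < N)%N.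

Variables (eta w : R).
Hypothesis F_tail : forall x y, 0 <= y -> 1 - F x <= expR (eta * y) * (1 - F (x + y)).
Hypothesis w_gt0 : 0 < w.
Hypothesis F_right : forall k : nat,
  N%:R * (1 - F (k.+1%:R * w)) <= 2 / (k.+1%:R * k.+2%:R).
Hypothesis F_left : forall k : nat, F (- (k%:R * w)) <= 2 / (k.+1%:R * k.+2%:R).

(* The excess loss [z (I 0) - z i] is replaced by counts of the levels that the
   perturbations cross, so that only tail probabilities enter the expectation;
   truncating at [K] levels is harmless because the loss is at most [T]. *)
Lemma leader_loss_le (z : 'I_N -> R) (I : nat -> 'I_N) (i : 'I_N) (K : nat) :
  (forall t, is_argmin (Lcum ell t) z (I t)) -> T%:R <= K%:R * w ->
  0 <= Lcum ell T i ->
  \sum_(t < T) ell t (I t.+1) <= Lcum ell T i + w +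
    (\sum_(j < N) \sum_(k < K) w * `[< k.+1%:R * w < z j >]%:R +
     \sum_(k < K) w * `[< z i <= - (k%:R * w) >]%:R).
Proof.
move=> HI TK L0.
have le_loss := be_the_perturbed_leader T HI i.
have lossT : \sum_(t < T) ell t (I t.+1) <= T%:R.
  have -> : T%:R = \sum_(t < T) 1 :> R by rewrite sumr_const card_ord.
  by apply: ler_sum => t _; have /andP[] := ell01 (I t.+1) (ltn_ord t).
set S1 := \sum_(j < N) _; set S2 := \sum_(k < K) w * `[< z i <= _ >]%:R.
(* The levels start at [w] rather than 0, below which summing over all experts is too crude; this
   costs the extra [w]. *)
have S1_ge : Num.min (z (I 0%N) - w) (K%:R * w) <= S1.
  apply: (le_trans (min_le_count _ K (ltW w_gt0))).
  rewrite /S1 (bigD1 (I 0%N))//= mulr_sumr ler_wpDr//.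
    by apply: sumr_ge0 => j _; apply: sumr_ge0 => k _; rewrite mulr_ge0 ?ler0n ?(ltW w_gt0).
  apply: ler_sum => k _; rewrite ler_pM2l// -natr1 mulrDl mul1r asboolb.
  by rewrite ltrBrDr.
have S2_ge : Num.min (- z i) (K%:R * w) <= S2.
  apply: (le_trans (min_le_count _ K (ltW w_gt0))).
  rewrite mulr_sumr; apply: ler_sum => k _; rewrite ler_pM2l// asboolb ler_nat.
  by have [/ltW|] := ltP (k%:R * w) (- z i); rewrite // lerNr => ->.
have S10 : 0 <= S1 by apply: sumr_ge0 => j _; apply: sumr_ge0 => k _; rewrite mulr_ge0 ?ler0n ?(ltW w_gt0).
have S20 : 0 <= S2 by apply: sumr_ge0 => k _; rewrite mulr_ge0 ?ler0n ?(ltW w_gt0).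
(* A capped count is at least [K * w >= T], and [lossT] concludes; if neither is capped, [le_loss]
   does. *)
move: S1_ge S2_ge; rewrite !ge_min => /orP[] h1 /orP[] h2; move: w_gt0; lra.
Qed.

(** The term [5 * w] is the offset [w] plus [2 * w] for each of the two tails. *)
Lemma sum_next_ftpl_prob_le (i : 'I_N) :
  \sum_(t < T) \sum_(j < N) ftpl_prob Z ell t.+1 j * ell t j <= Lcum ell T i + 5 * w.
Proof.
pose K := (truncn (T%:R / w)).+1.
have TK : T%:R <= K%:R * w by rewrite -ler_pdivrMr// ltW// truncnS_gt.
have L0 : 0 <= Lcum ell T i.
  by apply: sumr_ge0 => t _; have /andP[] := ell01 i (ltn_ord t).
pose X o := \sum_(t < T) \sum_(j < N)
  ell t j * `[< is_argmin (Lcum ell t.+1) (fun j => Z j o) j >]%:R.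
pose Y o := Lcum ell T i + w +
    (\sum_(j < N) \sum_(k < K) w * `[< k.+1%:R * w < Z j o >]%:R +
     \sum_(k < K) w * `[< Z i o <= - (k%:R * w) >]%:R).
have EX : has_mean P X (\sum_(t < T) \sum_(j < N) ell t j * ftpl_prob Z ell t.+1 j).
  apply: has_mean_sum => t; apply: has_mean_sum => j; apply: has_meanZ.
  exact: (has_mean_indic P (measurable_is_argmin Z _ j)).
have EY : has_mean P Y (Lcum ell T i + w +
    (\sum_(j < N) \sum_(k < K) w * (1 - F (k.+1%:R * w)) +
     \sum_(k < K) w * F (- (k%:R * w)))).
  apply: has_meanD; first exact: has_mean_cst.
  apply: has_meanD.
    apply: has_mean_sum => j; apply: has_mean_sum => k; apply: has_meanZ.
    rewrite -(pr_RV_gt Ziid j).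
    exact: (has_mean_indic P (measurable_RV_gt Z j _)).
  apply: has_mean_sum => k; apply: has_meanZ; rewrite -(pr_RV_le Ziid i).
  exact: (has_mean_indic P (measurable_RV_le Z i _)).
have XY o : X o <= Y o.
  have /choice[I HI] t := is_argmin_exists (Lcum ell t) (fun j => Z j o) (ltnW N1).
  have := leader_loss_le HI TK L0; rewrite -/(Y o); apply: le_trans.
  by rewrite /X; apply: ler_sum => t _; rewrite (sum_is_argmin _ (HI t.+1)).
under eq_bigr do under eq_bigr do rewrite mulrC.
apply: (le_trans (has_mean_le EX EY XY)).
have -> : \sum_(j < N) \sum_(k < K) w * (1 - F (k.+1%:R * w)) =
    w * \sum_(k < K) N%:R * (1 - F (k.+1%:R * w)).
  by rewrite sumr_const card_ord -[LHS]mulr_natl -!mulr_sumr mulrCA.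
have H1 : \sum_(k < K) N%:R * (1 - F (k.+1%:R * w)) <= 2.
  by apply: le_trans (sum_inv_triangular_le R K); apply: ler_sum => k _; exact: F_right.
have H2 : \sum_(k < K) F (- (k%:R * w)) <= 2.
  by apply: le_trans (sum_inv_triangular_le R K); apply: ler_sum => k _; exact: F_left.
have := ler_wpM2l (ltW w_gt0) H1; have := ler_wpM2l (ltW w_gt0) H2.
rewrite -[\sum_(k < K) w * F _]mulr_sumr; lra.
Qed.

Lemma ftpl_expected_regret_le : 0 <= eta ->
  ftpl_expected_regret Z ell T <= (expR eta - 1) * Lstar ell T + expR eta * (5 * w).
Proof.
move=> eta0; rewrite /ftpl_expected_regret.
have [i ei] := Lstar_attained ell T (ltnW N1); rewrite ei.
(* This is stability round by round, with [eta * ell t j <= eta]. *)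
suff : \sum_(t < T) \sum_(j < N) ftpl_prob Z ell t j * ell t j <=
    expR eta * \sum_(t < T) \sum_(j < N) ftpl_prob Z ell t.+1 j * ell t j.
  move=> /le_trans H; rewrite lerBlDr; apply: H.
  apply: (le_trans (ler_wpM2l (expR_ge0 eta) (sum_next_ftpl_prob_le i))).
  by rewrite mulrDr mulrBl mul1r addrAC subrK.
rewrite mulr_sumr; apply: ler_sum => t _; rewrite mulr_sumr; apply: ler_sum => j _.
have l0 k : 0 <= ell t k by have /andP[] := ell01 k (ltn_ord t).
rewrite mulrA ler_wpM2r//; apply: (le_trans (is_argmin_stable Ziid F_tail _ _ N1 l0)).
have -> : (fun k => Lcum ell t k + ell t k) = Lcum ell t.+1.
  by apply/funext => k; rewrite /Lcum big_ord_recr.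
rewrite ler_wpM2r//; first exact: pr_ge0.
by rewrite ler_expR ler_piMr//; have /andP[] := ell01 j (ltn_ord t).
Qed.

End Regret.

(** * Reduction to light tails and tuning of [eta] *)

Section Reduction.
Variable R : realType.

(** A single expert is treated apart: the target bound is then 0, and stability needs a rival. *)
Lemma ftpl_expected_regret1 d (Omega : measurableType d) (P : probability Omega R)
    (Z : 'I_1 -> {RV P >-> R}) (ell : nat -> 'I_1 -> R) (T : nat) :
  ftpl_expected_regret Z ell T = 0.
Proof.
have [i ei] := Lstar_attained ell T (ltn0Sn 0).
rewrite /ftpl_expected_regret ei /Lcum -sumrB big1// => t _.
rewrite big_ord1 /ftpl_prob (ord1 i).
have -> : [set w | is_argmin (Lcum ell t) (fun j => Z j w) ord0] = setT.
  by apply/seteqP; split => // w _ j; rewrite (ord1 j).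
by rewrite probability_setT mul1r subrr.
Qed.

(* The first condition bounds the hazard rate of [F] by [eta]; the other two
   make [E (max_i Z i - Z j)] of order [w], the right-hand sides being
   summable with sum [2]. *)
Definition light_tails (N : nat) (eta w : R) (F : R -> R) : Prop :=
  [/\ forall x y, 0 <= y -> 1 - F x <= expR (eta * y) * (1 - F (x + y)),
      forall k : nat, N%:R * (1 - F (k.+1%:R * w)) <= 2 / (k.+1%:R * k.+2%:R)
    & forall k : nat, F (- (k%:R * w)) <= 2 / (k.+1%:R * k.+2%:R)].

(** Follows from [expR (- x) >= 1 - x] and [(1 - x) * (1 + 2 * x) >= 1]. *)
Lemma expR_le1D2x (x : R) : 0 <= x <= 2^-1 -> expR x <= 1 + 2 * x.
Proof.
move=> /andP[x0 x2]; rewrite -[x in expR x]opprK expRN.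
rewrite -[leRHS]invrK lef_pV2 ?posrE ?expR_gt0 ?invr_gt0//; last by lra.
apply: le_trans (expR_ge1Dx (- x)); rewrite -div1r ler_pdivrMr; nra.
Qed.

Lemma achieves_small_loss_regret_light_tails (Theta : Type) (ok : Theta -> Prop)
    (F : Theta -> R -> R) (c : R) (par : nat -> R -> Theta) : 0 < c ->
  (forall N eta, 0 < eta -> ok (par N eta)) ->
  (forall N eta, (1 < N)%N -> 0 < eta ->
    light_tails N eta (c * ln N%:R / eta) (F (par N eta))) ->
  achieves_small_loss_regret ok F.
Proof.
(* This balances [eta * Ls] against [ln N / eta], and the 2 keeps [eta] at most 1/2. It is positive
   for every input, as division by [ln 1 = 0] yields 0. *)
move=> c0 okpar tails; pose eta N Ls : R := (2 + Num.sqrt (Ls / ln N%:R))^-1.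
have eta0 N Ls : 0 < eta N Ls by rewrite invr_gt0 ltr_wpDr// sqrtr_ge0.
(* With [l = ln N] and [s = sqrt (L / l)], stability costs [2 * (s * l)] and the tails cost
   [10 * (c * l * (2 + s))]. *)
exists (2 + 20 * c), (fun N Ls => par N (eta N Ls)); split; first by move=> *; exact: okpar.
move=> N T ell N0 ell01 d Omega P Z Ziid.
have [N1|] := ltnP 1 N; last first.
  move=> N1; have eN : N = 1%N by apply/eqP; rewrite eqn_leq N1.
  move: ell ell01 Z Ziid; rewrite eN => ell _ Z _.
  by rewrite ftpl_expected_regret1 ln1 mulr0 sqrtr0 addr0 mulr0.
have [F1 F2 F3] := tails N (eta N (Lstar ell T)) N1 (eta0 _ _).
have lN : 0 < ln N%:R :> R by rewrite ln_gt0// ltr1n.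
have w0 : 0 < c * ln N%:R / eta N (Lstar ell T) by rewrite divr_gt0// mulr_gt0.
apply: le_trans (ftpl_expected_regret_le Ziid ell01 N1 F1 w0 F2 F3 (ltW (eta0 _ _))) _.
have L0 : 0 <= Lstar ell T.
  have [i ->] := Lstar_attained ell T N0.
  by apply: sumr_ge0 => t _; have /andP[] := ell01 t i (ltn_ord t).
move: (Lstar ell T) L0 (eta0 N (Lstar ell T)) => L L0; rewrite /eta.
set l := ln N%:R in lN *; set s := Num.sqrt (L / l) => h0.
have s0 : 0 <= s by exact: sqrtr_ge0.
have eL : L = s ^+ 2 * l by rewrite sqr_sqrtr ?divr_ge0// ?divfK ?gt_eqF// ltW.
have -> : Num.sqrt (L * l) = s * l.
  by rewrite eL -mulrA -expr2 -exprMn sqrtr_sqr ger0_norm// mulr_ge0// ltW.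
have h2 : (2 + s)^-1 <= 2^-1 by rewrite lef_pV2 ?posrE; lra.
have hE := expR_le1D2x (introT andP (conj (ltW h0) h2)).
rewrite invrK.
set h := (2 + s)^-1 in h0 h2 hE *; have hs : h * (2 + s) = 1 by rewrite mulVf// gt_eqF; lra.
have hsL : h * L <= s * l.
  have -> : h * L = h * s * (s * l) by rewrite eL; ring.
  by rewrite ler_piMl ?mulr_ge0 ?(ltW lN)//; move: hs; rewrite mulrDr; lra.
have wl : 0 <= c * l * (2 + s) by rewrite !mulr_ge0 ?ltW; lra.
have A1 : (expR h - 1) * L <= 2 * (s * l) by nra.
have A2 : expR h * (5 * (c * l * (2 + s))) <= 10 * (c * l * (2 + s)) by nra.
have := mulr_ge0 s0 (ltW lN); have := mulr_ge0 (ltW c0) (mulr_ge0 s0 (ltW lN)).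
lra.
Qed.

End Reduction.

(** * Elementary estimates for hazard rates and tails *)

Section Estimates.
Variable R : realType.
Implicit Types (x y u eta : R) (k N : nat).

(** Concavity in [c]: the tangent to the exponential at [- (c * u)] is evaluated at 0 and [- u],
    with weights [1 - c] and [c]. *)
Lemma expRN_chord (c u : R) : 0 <= c <= 1 -> c * (1 - expR (- u)) <= 1 - expR (- (c * u)).
Proof.
move=> /andP[c0 c1].
have h1 : expR (- (c * u)) * (1 + c * u) <= 1.
  by rewrite -[leRHS](expRxMexpNx_1 (c * u)) mulrC ler_wpM2r ?expR_ge0 ?expR_ge1Dx.
have h2 : expR (- (c * u)) * (1 + (c * u - u)) <= expR (- u).
  rewrite [in leRHS](_ : - u = - (c * u) + (c * u - u)); last by ring.
  by rewrite expRD ler_wpM2l ?expR_ge0 ?expR_ge1Dx.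
nra.
Qed.

Lemma ln_incr_le (a x y : R) : 0 < a -> a <= x -> 0 <= y -> ln (x + y) <= ln x + y / a.
Proof.
move=> a0 ax y0; have x0 : 0 < x by lra.
have -> : x + y = x * (1 + y / x) by rewrite mulrDr mulr1 mulrCA divff ?gt_eqF// mulr1.
have yx : 0 <= y / x by rewrite divr_ge0// ltW.
rewrite lnM ?posrE//; last by lra.
rewrite lerD2l; apply: (le_trans (le_ln1Dx _)); first lra.
by rewrite ler_wpM2l// lef_pV2.
Qed.

Lemma half_le_ln N : (1 < N)%N -> 2^-1 <= ln N%:R :> R.
Proof.
move=> N1; rewrite -[leLHS](expRK 2^-1) ler_ln ?posrE ?expR_gt0 ?ltr0n 1?(ltn_trans _ N1)//.
apply: (@le_trans _ _ 2); last by rewrite ler_nat.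
by apply: (le_trans (expR_le1D2x _)); lra.
Qed.

Lemma triangular_le_exp4 k : k.+1%:R * k.+2%:R <= 2 * 4 ^+ k :> R.
Proof.
elim: k => [|k IH]; first by rewrite expr0; lra.
rewrite exprS; have k0 : 0 <= k%:R :> R by [].
move: IH; rewrite -(natr1 k.+2) -(natr1 k.+1) -(natr1 k); nra.
Qed.

Lemma exp4_le_expR N k : (1 < N)%N -> 4 ^+ k <= expR (k%:R * (2 * ln N%:R)) :> R.
Proof.
move=> N1; rewrite expRM_natl lerXn2r ?nnegrE ?expR_ge0//.
rewrite expRM_natl lnK ?posrE ?ltr0n 1?(ltn_trans _ N1)//.
have -> : 4 = 2 ^+ 2 :> R by ring.
by rewrite lerXn2r ?nnegrE// ler_nat.
Qed.

Lemma inv_le_triangular (a : R) k : 4 ^+ k <= a -> a^-1 <= 2 / (k.+1%:R * k.+2%:R).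
Proof.
move=> ha; have a0 : 0 < a by apply: lt_le_trans ha; rewrite exprn_gt0.
rewrite -div1r ler_pdivrMr// mulrAC ler_pdivlMr ?mulr_gt0 ?ltr0n// mul1r.
by apply: (le_trans (triangular_le_exp4 k)); rewrite ler_wpM2l.
Qed.

(** Of the decay [N ^ (-2 (k + 1))], a factor [N ^ (-2)] absorbs the union bound over experts, and
    the rest is at most [4 ^ (-k)]. *)
Lemma exponential_tail_le N k : (1 < N)%N ->
  N%:R * expR (- (k.+1%:R * (2 * ln N%:R))) <= 2 / (k.+1%:R * k.+2%:R) :> R.
Proof.
move=> N1; have lN := half_le_ln N1.
have N0 : 0 < N%:R :> R by rewrite ltr0n (ltn_trans _ N1).
rewrite -{1}(lnK (x := N%:R)) ?posrE// -expRD.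
apply: le_trans (inv_le_triangular (exp4_le_expR k N1)).
by rewrite -expRN ler_expR -natr1; lra.
Qed.

(** The factor [expR 1] in the level contributes [N ^ (-4)], which absorbs [N]; the exponent
    [4 * ln N >= 2] yields [(k + 1) ^ (-2)]. *)
Lemma polynomial_tail_le N k : (1 < N)%N ->
  N%:R * expR (- (4 * ln N%:R * ln (k.+1%:R * expR 1))) <= 2 / (k.+1%:R * k.+2%:R) :> R.
Proof.
move=> N1; have lN := half_le_ln N1.
have N0 : 0 < N%:R :> R by rewrite ltr0n (ltn_trans _ N1).
have K0 : 0 < k.+1%:R :> R by rewrite ltr0n.
have lk : 0 <= ln k.+1%:R :> R by rewrite ln_ge0// ler1n.
rewrite -{1}(lnK (x := N%:R)) ?posrE// -expRD lnM ?posrE ?expR_gt0// expRK.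
apply: (@le_trans _ _ (expR (- (2%:R * ln k.+1%:R)))); first by rewrite ler_expR; nra.
rewrite expRN expRM_natl lnK ?posrE//.
rewrite -div1r ler_pdivrMr ?exprn_gt0// mulrAC ler_pdivlMr ?mulr_gt0 ?ltr0n//.
have k0 : 0 <= k%:R :> R by [].
rewrite -(natr1 k.+1) -(natr1 k); nra.
Qed.

End Estimates.

(** * The exponential law, as Weibull and Gamma of shape 1 *)

Section Exponential.
Variable R : realType.

Definition exponential_cdf (eta x : R) : R := if x <= 0 then 0 else 1 - expR (- (eta * x)).

Lemma light_tails_exponential N (eta : R) : (1 < N)%N -> 0 < eta ->
  light_tails N eta (2 * ln N%:R / eta) (exponential_cdf eta).
Proof.
move=> N1 eta0; have lN := half_le_ln R N1; have w0 : 0 < 2 * ln N%:R / eta.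
  by rewrite divr_gt0//; lra.
(* With the maximum, one formula covers both signs; the log-survival has slope 0 or [- eta]. *)
have SE x : 1 - exponential_cdf eta x = expR (- (eta * Num.max 0 x)).
  rewrite /exponential_cdf; case: (leP x 0) => x0; last by rewrite opprB addrC subrK.
  by rewrite subr0 mulr0 oppr0 expR0.
split.
- move=> x y y0; rewrite !SE -expRD ler_expR.
  have -> : eta * y - eta * Num.max 0 (x + y) = - (eta * (Num.max 0 (x + y) - y)) by ring.
  rewrite lerN2 ler_pM2l// lerBlDr ge_max.
  by rewrite addr_ge0 ?le_max ?lexx//= lerD2r le_max lexx orbT.
- move=> k; rewrite SE max_r; last by rewrite mulr_ge0 ?(ltW w0).
  have -> : eta * (k.+1%:R * (2 * ln N%:R / eta)) = k.+1%:R * (2 * ln N%:R).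
    by field; rewrite gt_eqF.
  exact: exponential_tail_le.
- by move=> k; rewrite /exponential_cdf oppr_le0 mulr_ge0 ?(ltW w0).
Qed.

Lemma weibull_cdf1 (eta : R) : 0 < eta -> weibull_cdf (1, eta^-1) = exponential_cdf eta.
Proof.
move=> eta0; apply/funext => x; rewrite /weibull_cdf /exponential_cdf /= invrK.
by case: (leP x 0) => // x0; rewrite powRr1 ?(mulrC x)// mulr_ge0 ?ltW.
Qed.

(** On negative reals [exponential_pdf] vanishes but [gamma_dens] of shape 1 does not, whence the
    restriction on [D]. The factor [eta^-1] cancels in [gamma_cdf]. *)
Lemma gamma_dens1 (eta : R) (D : set R) : 0 < eta -> D `<=` `[0, +oo[ ->
  (\int[lebesgue_measure]_(y in D) (gamma_dens (1%R, eta^-1) y)%:E =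
   \int[lebesgue_measure]_(y in D) (eta^-1 * exponential_pdf eta y)%:E)%E.
Proof.
move=> eta0 D0; apply: eq_integral => y; rewrite inE => /D0 /=; rewrite in_itv /= andbT => y0.
rewrite exponential_pdfE// /gamma_dens /= subrr powRr0 mul1r invrK mulrA mulVf ?gt_eqF//.
by rewrite mul1r mulNr mulrC.
Qed.

Lemma gamma_cdf1 (eta : R) : 0 < eta -> gamma_cdf (1, eta^-1) = exponential_cdf eta.
Proof.
move=> eta0; apply/funext => x; rewrite /gamma_cdf /exponential_cdf.
case: (leP x 0) => // x0.
have iV : lebesgue_measure.-integrable setT (EFin \o exponential_pdf eta).
  exact: integrable_exponential_pdf.
have mpdf D : measurable_fun D (EFin \o exponential_pdf eta).
  by apply: measurable_funTS; case/integrableP: iV.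
rewrite !gamma_dens1//; last 2 first.
- by move=> y /=; rewrite !in_itv /= !andbT => /ltW.
- by move=> y /=; rewrite !in_itv /= => /andP[/ltW ->].
under eq_integral do rewrite EFinM.
under [in X in _ / X]eq_integral do rewrite EFinM.
rewrite !integralZl//; last 2 first.
- by apply: (integrableS measurableT) iV.
- by apply: (integrableS measurableT) iV.
rewrite !integral_itv_obnd_cbnd//.
have -> : (\int[lebesgue_measure]_(y in `[0%R, x]) (exponential_pdf eta y)%:E =
    (1 - expR (- eta * x))%R%:E)%E by rewrite -/(exponential_prob eta _) exponential_prob_itv0c.
have -> : (\int[lebesgue_measure]_(y in `[0%R, +oo[) (exponential_pdf eta y)%:E = 1)%E.
  rewrite -(integral_exponential_pdf eta0) [LHS]integral_mkcond.
  apply: eq_integral => y _; rewrite patchE; case: ifPn => //.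
  rewrite notin_setE /= in_itv /= andbT => /negP; rewrite -ltNge => y0.
  by rewrite lt0_exponential_pdf.
by rewrite -EFinM mule1 /= mulNr mulrAC divff ?mul1r// invr_eq0 gt_eqF.
Qed.

End Exponential.

(** * The Gumbel law *)

Section Gumbel.
Variable R : realType.

Lemma one_minus_expRN_le (u : R) : 1 - expR (- u) <= u.
Proof. by have := expR_ge1Dx (- u); lra. Qed.

(** A shift by [y] multiplies [expR (- (eta * x))] by [expR (- (eta * y))], so the hazard bound is
    [expRN_chord]. The right tail is at most exponential, and the left one doubly exponential. *)
Lemma light_tails_gumbel N (eta : R) : (1 < N)%N -> 0 < eta ->
  light_tails N eta (2 * ln N%:R / eta) (gumbel_cdf (0, eta^-1)).
Proof.
move=> N1 eta0.
have FE x : gumbel_cdf (0, eta^-1) x = expR (- expR (- (eta * x))).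
  by rewrite /gumbel_cdf /= subr0 invrK mulrC.
have ew k : eta * (k%:R * (2 * ln N%:R / eta)) = k%:R * (2 * ln N%:R).
  by field; rewrite gt_eqF.
split.
- move=> x y y0; rewrite !FE.
  have c1 : 0 <= expR (- (eta * y)) <= 1.
    by rewrite expR_ge0 expR_le1 oppr_le0 mulr_ge0// ltW.
  have := expRN_chord (expR (- (eta * x))) c1.
  rewrite -expRD -opprD -mulrDr (addrC y) expRN mulrC ler_pdivrMr ?expR_gt0//.
  by rewrite [leRHS]mulrC.
- move=> k; rewrite FE ew; apply: le_trans (exponential_tail_le _ k N1).
  by rewrite ler_wpM2l// one_minus_expRN_le.
- move=> k; rewrite FE mulrN opprK ew expRN.
  apply: inv_le_triangular; apply: (le_trans (exp4_le_expR _ k N1)).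
  by apply: le_trans (expR_ge1Dx _); rewrite lerDr.
Qed.

End Gumbel.

(** * The Pareto law *)

Section PolynomialTails.
Variable R : realType.

Lemma pareto_cdfE (a b x : R) : 0 < b ->
  1 - pareto_cdf (a, b) x = expR (- (a * (ln (Num.max b x) - ln b))).
Proof.
move=> b0; rewrite /pareto_cdf /=; case: (leP x b) => xb.
  by rewrite subr0 subrr mulr0 oppr0 expR0.
have x0 : 0 < x by exact: lt_trans xb.
rewrite opprB addrC subrK /powR gt_eqF ?divr_gt0// ln_div ?posrE//.
by rewrite -mulrN opprB.
Qed.

(** The hazard rate [a / x] beyond [b] is at most [a / b = eta], which dictates the scale. The unit
    [w] is [expR 1 * b], as [polynomial_tail_le] requires. *)
Lemma light_tails_pareto N (eta : R) : (1 < N)%N -> 0 < eta ->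
  light_tails N eta (4 * expR 1 * ln N%:R / eta)
    (pareto_cdf (4 * ln N%:R, 4 * ln N%:R / eta)).
Proof.
move=> N1 eta0; have lN := half_le_ln R N1; set a := 4 * ln N%:R; set b := a / eta.
have a0 : 0 < a by rewrite /a; lra.
have b0 : 0 < b by rewrite divr_gt0.
have -> : 4 * expR 1 * ln N%:R / eta = expR 1 * b by rewrite /b /a; ring.
split.
- move=> x y y0; rewrite !pareto_cdfE// -expRD ler_expR.
  set M := Num.max b x; have bM : b <= M by rewrite le_max lexx.
  have : ln (Num.max b (x + y)) <= ln M + y / b.
    apply: le_trans (ln_incr_le b0 bM y0).
    rewrite ler_ln ?posrE ?lt_max ?b0//; last by lra.
    have xM : x <= M by rewrite le_max lexx orbT.
    by rewrite ge_max; apply/andP; split; lra.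
  have -> : y / b = eta * y / a by rewrite /b invf_div mulrCA mulrA.
  rewrite -(ler_pM2l a0) mulrDr [a * (_ / a)]mulrC divfK ?gt_eqF//; lra.
- move=> k; rewrite pareto_cdfE//.
  have k1 : 1 <= k.+1%:R :> R by rewrite ler1n.
  have e1 : 1 <= expR 1 :> R by have := @expR_ge1Dx R 1; lra.
  rewrite max_r; last by rewrite mulrA ler_peMl ?(ltW b0)// mulr_ege1.
  have ke : 0 < k.+1%:R * expR 1 :> R by rewrite mulr_gt0 ?expR_gt0.
  rewrite [k.+1%:R * _]mulrA [ln (_ * b)]lnM ?posrE// addrK.
  exact: polynomial_tail_le.
- move=> k; rewrite /pareto_cdf /= ifT.
    by rewrite divr_ge0// mulr_ge0.
  apply: (@le_trans _ _ 0); last exact: ltW.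
  by rewrite oppr_le0 mulr_ge0//; apply: mulr_ge0; [exact: expR_ge0|exact: ltW].
Qed.

End PolynomialTails.

(** Read as [1 - expR (- p) >= expR (- p) * p ^+ 2 / 2], it bounds the Frechet survival function
    from below. *)
Lemma mulr_expRN_le1 (R : realType) (p : R) : 0 <= p -> expR (- p) * (1 + p ^+ 2 / 2) <= 1.
Proof.
move=> p0; rewrite -[leRHS](expRxMexpNx_1 p) mulrC ler_wpM2r ?expR_ge0//.
by have := expR_ge1Dxn 1 p0.
Qed.

(** * The Frechet law *)

Section Frechet.
Variable R : realType.
Variables (a s : R).
Hypotheses (a1 : 1 <= a) (s0 : 0 < s).
Let S x : R := 1 - frechet_cdf (a, s, 0) x.
(** For positive [x] this is the power [(x / s) ^ (-a)]. *)
Let u x : R := expR (- (a * (ln x - ln s))).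
(** Beyond [s] the rate [a / s] would do; the factor 4 is spent below [s]. *)
Let eta : R := 4 * a / s.

Let S_le0 x : x <= 0 -> S x = 1.
Proof. by move=> x0; rewrite /S /frechet_cdf /= x0 subr0. Qed.

Let S_gt0 x : 0 < x -> S x = 1 - expR (- u x).
Proof.
move=> x0; rewrite /S /frechet_cdf /= leNgt x0 /= subr0 /powR gt_eqF ?divr_gt0//.
by rewrite ln_div ?posrE// mulNr.
Qed.

Let S_ge0 x : 0 <= S x.
Proof.
have [/S_le0->//|x0] := leP x 0.
by rewrite S_gt0// subr_ge0 expR_le1 oppr_le0 expR_ge0.
Qed.

Let ln_scaled_incr x y : s <= x -> x <= y -> a * (ln y - ln x) <= eta * (y - x).
Proof.
have sp := s0; have ap := a1.
move=> sx xy; have : ln y <= ln x + (y - x) / s.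
  have yx : 0 <= y - x by rewrite subr_ge0.
  by have := ln_incr_le s0 sx yx; rewrite subrKC.
have a0 : 0 < a := lt_le_trans ltr01 a1.
have ys : 0 <= (y - x) / s by rewrite divr_ge0 ?subr_ge0// ltW.
have -> : eta * (y - x) = 4 * (a * ((y - x) / s)) by rewrite /eta; ring.
nra.
Qed.

(** Since [u y = (x / y) ^ a * u x], [expRN_chord] bounds the ratio of survivals by
    [(y / x) ^ a]. *)
Lemma frechet_hazard_right x y : s <= x -> x <= y -> S x <= expR (eta * (y - x)) * S y.
Proof.
have sp := s0; have ap := a1.
move=> sx xy; have x0 : 0 < x by lra.
have y0 : 0 < y by lra.
pose c := expR (- (a * (ln y - ln x))).
have uy : u y = c * u x by rewrite /u /c -expRD; congr expR; ring.
have lxy : ln x <= ln y by rewrite ler_ln ?posrE.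
have c1 : 0 <= c <= 1.
  by rewrite expR_ge0 expR_le1 oppr_le0 mulr_ge0//; lra.
have := expRN_chord (u x) c1; rewrite -uy -!S_gt0// /c expRN mulrC ler_pdivrMr ?expR_gt0//.
move=> /le_trans; apply; rewrite mulrC ler_wpM2r ?S_ge0// ler_expR; exact: ln_scaled_incr.
Qed.

Let one_le_u x : 0 < x -> x <= s -> 1 <= u x /\ s <= x * u x.
Proof.
have sp := s0; have ap := a1.
move=> x0 xs; have lxs : ln x <= ln s by rewrite ler_ln ?posrE.
split; first by rewrite -expR0 ler_expR; nra.
rewrite -{1}(lnK (x := s)) ?posrE// -{1}(lnK (x := x)) ?posrE// -expRD ler_expR; nra.
Qed.

(* With [p = u y] and [q = u x], [S x / S y - 1 = (1 - expR (p - q)) / (expR p - 1)],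
   to be compared with [eta (y - x)]. *)
Lemma frechet_hazard_left x y : 0 < x -> x <= y -> y <= s ->
  S x <= expR (eta * (y - x)) * S y.
Proof.
have sp := s0; have ap := a1.
move=> x0 xy ys; have y0 : 0 < y by lra.
have [uy1 ysu] := one_le_u y0 ys.
have lxy : ln x <= ln y by rewrite ler_ln ?posrE.
have uxy : u y <= u x by rewrite ler_expR; nra.
have ux0 : 0 < u x by exact: expR_gt0.
have a0 : 0 < a := lt_le_trans ltr01 a1.
(* Bernoulli's inequality [1 - r ^ a <= a * (1 - r)] at [r = x / y], obtained from the chord with
   [c = 1 / a]. *)
have av : y * (u x - u y) <= a * (y - x) * u x.
  have c1 : 0 <= a^-1 <= 1 by rewrite invr_ge0 (ltW a0) invf_le1.
  have := expRN_chord (a * (ln y - ln x)) c1.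
  rewrite mulKf ?gt_eqF//.
  have -> : - (ln y - ln x) = ln x - ln y by ring.
  rewrite expRB !lnK ?posrE//.
  have -> : expR (- (a * (ln y - ln x))) = u y / u x.
    by rewrite /u -expRB; congr expR; ring.
  move=> /(ler_wpM2l (ltW (mulr_gt0 (mulr_gt0 a0 y0) ux0))).
  have -> : a * y * u x * (a^-1 * (1 - u y / u x)) = y * (u x - u y).
    by field; rewrite !gt_eqF.
  by have -> : a * y * u x * (1 - x / y) = a * (y - x) * u x by field; rewrite gt_eqF.
set h := eta * (y - x); have hs : h * s = 4 * (a * (y - x)).
  by rewrite /h /eta; field; rewrite gt_eqF.
set q := u x in uxy ux0 av *; set p := u y in uy1 ysu uxy av *.
have hpq : 4 * (q - p) <= h * p * q.
  have d0 : 0 <= q - p by lra.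
  rewrite -(ler_pM2l s0); apply: (@le_trans _ _ (4 * (y * p * (q - p)))); first by nra.
  have -> : s * (h * p * q) = 4 * (p * (a * (y - x) * q)) by rewrite mulrA mulrA [s * h]mulrC hs; ring.
  have p0 : 0 <= p by lra.
  have := ler_wpM2l p0 av; lra.
have h0 : 0 <= h.
  by rewrite /h /eta mulr_ge0 ?subr_ge0// divr_ge0 ?(ltW s0)// mulr_ge0 ?(ltW a0).
rewrite !S_gt0// -/q -/p; apply: (@le_trans _ _ ((1 + h) * (1 - expR (- p)))); last first.
  by rewrite ler_wpM2r ?expR_ge1Dx// subr_ge0 expR_le1; lra.
have -> : expR (- q) = expR (- p) * expR (- (q - p)) by rewrite -expRD; congr expR; ring.
have p0 : 0 <= p by lra.
have Ep := mulr_expRN_le1 p0; have E0 := expR_ge0 (- p).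
have G1 := expR_ge1Dx (- (q - p)); have G0 := expR_ge0 (- (q - p)).
set E := expR (- p) in Ep E0 *; set G := expR (- (q - p)) in G1 G0 *.
(* The goal amounts to [E * (1 - G) <= h * (1 - E)], and [Ep] gives [1 - E >= E * (p ^+ 2 / 2)]. *)
suff : 1 - G <= h * p ^+ 2 / 2.
  have : h * (E * (p ^+ 2 / 2)) <= h * (1 - E) by rewrite ler_wpM2l//; lra.
  nra.
(* With [d = q - p], [1 - G] is at most [d] and at most 1, so [(1 - G) * (p + d) <= d * p + d <= 2 *
   d * p] as [p >= 1]; the rest is [hpq]. *)
rewrite -(ler_pM2r ux0); apply: (@le_trans _ _ (2 * (q - p) * p)); nra.
Qed.

(** From [y * p >= s] and [y <= a * (y - x)] comes [h * p >= 4], so [h] is large enough whenever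
    [S y] is bounded below only through [p]. *)
Lemma frechet_hazard_neg x y : x <= 0 -> 0 < y -> y <= s ->
  S x <= expR (eta * (y - x)) * S y.
Proof.
have sp := s0; have ap := a1.
move=> x0 y0 ys; have [uy1 ysu] := one_le_u y0 ys.
rewrite (S_le0 x0) S_gt0//; set p := u y in uy1 ysu *; set h := eta * (y - x).
have p0 : 0 <= p by lra.
have hp : 4 <= h * p.
  have hs : h * s = 4 * (a * (y - x)) by rewrite /h /eta; field; rewrite gt_eqF.
  have ya : y <= a * (y - x) by nra.
  rewrite -(ler_pM2r s0) [h * p * s]mulrAC hs; have := ler_wpM2r p0 ya; lra.
have h0 : 0 <= h by nra.
apply: (@le_trans _ _ ((1 + h) * (1 - expR (- p)))); last first.
  by rewrite ler_wpM2r ?expR_ge1Dx// subr_ge0 expR_le1; lra.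
have Ep := mulr_expRN_le1 p0; have E0 := expR_ge0 (- p).
set E := expR (- p) in Ep E0 *.
have : h * (E * (p ^+ 2 / 2)) <= h * (1 - E) by rewrite ler_wpM2l//; lra.
nra.
Qed.

(** Such bounds compose through an intermediate point, here [s]. *)
Lemma frechet_hazard x y : x <= y -> S x <= expR (eta * (y - x)) * S y.
Proof.
have sp := s0; have ap := a1.
have eta0 : 0 <= eta by rewrite /eta divr_ge0 ?(ltW s0)//; lra.
have trans m : S x <= expR (eta * (m - x)) * S m ->
    S m <= expR (eta * (y - m)) * S y -> S x <= expR (eta * (y - x)) * S y.
  move=> H1 H2; apply: (le_trans H1).
  have -> : eta * (y - x) = eta * (m - x) + eta * (y - m) by ring.
  by rewrite expRD -mulrA ler_wpM2l ?expR_ge0.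
move=> xy; have [y0|y0] := leP y 0.
  rewrite (S_le0 y0) (S_le0 (le_trans xy y0)) mulr1 -expR0 ler_expR mulr_ge0//.
  by rewrite subr_ge0.
have [x0|x0] := leP x 0.
  have [ys|sy] := leP y s; first exact: frechet_hazard_neg.
  by apply: (trans s); [exact: frechet_hazard_neg|apply: frechet_hazard_right; lra].
have [sx|xs] := leP s x; first exact: frechet_hazard_right.
have [ys|sy] := leP y s; first exact: frechet_hazard_left.
by apply: (trans s); [apply: frechet_hazard_left; lra|apply: frechet_hazard_right; lra].
Qed.

Lemma frechet_tail x : 0 < x -> S x <= expR (- (a * (ln x - ln s))).
Proof. by move=> x0; rewrite S_gt0// one_minus_expRN_le. Qed.

End Frechet.

(** The scale [s] solves [eta = 4 * a / s], and [w = expR 1 * s]. *)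
Lemma light_tails_frechet (R : realType) N (eta : R) : (1 < N)%N -> 0 < eta ->
  light_tails N eta (16 * expR 1 * ln N%:R / eta)
    (frechet_cdf (4 * ln N%:R, 16 * ln N%:R / eta, 0)).
Proof.
move=> N1 eta0; have lN := half_le_ln R N1.
set a := 4 * ln N%:R; set s := 16 * ln N%:R / eta.
have a1 : 1 <= a by rewrite /a; lra.
have s0 : 0 < s by rewrite divr_gt0//; lra.
have -> : 16 * expR 1 * ln N%:R / eta = expR 1 * s by rewrite /s; ring.
have etaE : eta = 4 * a / s.
  by rewrite /s /a; field; rewrite !gt_eqF//; lra.
split.
- move=> x y y0; have xy : x <= x + y by rewrite lerDl.
  have := frechet_hazard a1 s0 xy; rewrite -etaE.
  by have -> : x + y - x = y by ring.
- move=> k; have w0 : 0 < k.+1%:R * (expR 1 * s).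
    by rewrite mulr_gt0//; apply: mulr_gt0 => //; exact: expR_gt0.
  apply: le_trans (polynomial_tail_le _ k N1); rewrite ler_wpM2l//.
  apply: (le_trans (frechet_tail _ s0 w0)).
  have ke : 0 < k.+1%:R * expR 1 :> R by rewrite mulr_gt0 ?expR_gt0.
  by rewrite [k.+1%:R * _]mulrA [ln (_ * s)]lnM ?posrE// addrK.
- move=> k; rewrite /frechet_cdf /= ifT.
    by rewrite divr_ge0// mulr_ge0.
  by rewrite oppr_le0 mulr_ge0//; apply: mulr_ge0; [exact: expR_ge0|exact: ltW].
Qed.

Theorem theorem2 (R : realType) :
  achieves_small_loss_regret (@gamma_ok R) (@gamma_cdf R) /\
  achieves_small_loss_regret (@gumbel_ok R) (@gumbel_cdf R) /\
  achieves_small_loss_regret (@frechet_ok R) (@frechet_cdf R) /\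
  achieves_small_loss_regret (@weibull_ok R) (@weibull_cdf R) /\
  achieves_small_loss_regret (@pareto_ok R) (@pareto_cdf R).
Proof.
have e0 : 0 < expR 1 :> R by exact: expR_gt0.
(* Parameters must be admissible for every [N]: [maxn N 2] keeps them positive when [N] is 0 or 1
   and changes nothing otherwise. *)
have lN0 N : 0 < ln (maxn N 2)%:R :> R.
  by have := @half_le_ln R (maxn N 2) (leq_maxr N 2); lra.
split; [|split; [|split; [|split]]].
- apply: (@achieves_small_loss_regret_light_tails _ _ _ _ 2 (fun _ eta => (1, eta^-1))) => //.
    by move=> N eta eta0; split=> /=; rewrite ?ltr01 ?invr_gt0.
  by move=> N eta N1 eta0; rewrite gamma_cdf1//; exact: light_tails_exponential.
- apply: (@achieves_small_loss_regret_light_tails _ _ _ _ 2 (fun _ eta => (0, eta^-1))) => //.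
    by move=> N eta eta0; rewrite /gumbel_ok /= invr_gt0.
  by move=> N eta N1 eta0; exact: light_tails_gumbel.
- apply: (@achieves_small_loss_regret_light_tails _ _ _ _ (16 * expR 1)
    (fun N eta => (4 * ln (maxn N 2)%:R, 16 * ln (maxn N 2)%:R / eta, 0))).
  + by rewrite mulr_gt0.
  + by move=> N eta eta0; split=> /=; rewrite ?divr_gt0 ?mulr_gt0.
  + by move=> N eta N1 eta0; rewrite (maxn_idPl N1); exact: light_tails_frechet.
- apply: (@achieves_small_loss_regret_light_tails _ _ _ _ 2 (fun _ eta => (1, eta^-1))) => //.
    by move=> N eta eta0; split=> /=; rewrite ?ltr01 ?invr_gt0.
  by move=> N eta N1 eta0; rewrite weibull_cdf1//; exact: light_tails_exponential.
- apply: (@achieves_small_loss_regret_light_tails _ _ _ _ (4 * expR 1)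
    (fun N eta => (4 * ln (maxn N 2)%:R, 4 * ln (maxn N 2)%:R / eta))).
  + by rewrite mulr_gt0.
  + by move=> N eta eta0; split=> /=; rewrite ?divr_gt0 ?mulr_gt0.
  + by move=> N eta N1 eta0; rewrite (maxn_idPl N1); exact: light_tails_pareto.
Qed.
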